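(* Let $(X,\mathcal{I})$ be a Polish ideal space and let $Y$ be an uncountable Polish space. Suppose $f:X\rightarrow Y$ is a $\overline{\mathcal{B}}(X)$-measurable map such that $f^{-1}(\{y\})\in\mathcal{I}$ for every $y\in Y$. Then there is a set $T\subseteq Y$ such that $f^{-1}(T)$ is completely $\mathcal{I}$-nonmeasurable.
   Context: $\mathcal{B}(X)$ is the Borel $\sigma$-algebra of $X$. A pair $(X,\mathcal{I})$ is a Polish ideal space if $X$ is an uncountable Polish space and $\mathcal{I}$ is a proper $\sigma$-ideal of subsets of $X$ that contains all singletons and has a Borel base, i.e. every $A\in\mathcal{I}$ is contained in a Borel set belonging to $\mathcal{I}$. Put $\mathcal{B}_+(X)=\mathcal{B}(X)\setminus\mathcal{I}$, and let $\overline{\mathcal{B}}(X)$ be the $\sigma$-algebra on $X$ generated by $\mathcal{B}(X)\cup\mathcal{I}$. A map $f:X\to Y$ is $\overline{\mathcal{B}}(X)$-measurable if $f^{-1}(U)\in\overline{\mathcal{B}}(X)$ for every open $U\subseteq Y$. A set $A\subseteq X$ is completely $\mathcal{I}$-nonmeasurable if for every $B\in\mathcal{B}_+(X)$ both $A\cap B\neq\emptyset$ and $(X\setminus A)\cap B\neq\emptyset$. *)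

(* Defs.v *)
From mathcomp Require Import all_boot all_order all_algebra.
From mathcomp Require Import all_classical all_reals topology measure.

Set Implicit Arguments.
Unset Strict Implicit.
Unset Printing Implicit Defensive.

Import Order.TTheory GRing.Theory Num.Theory.
Local Open Scope classical_set_scope.
Local Open Scope ring_scope.

Definition separable_space (X : topologicalType) : Prop :=
  exists2 D : set X, countable D & dense D.

Definition is_metric (R : realType) (X : Type) (d : X -> X -> R) : Prop :=
  [/\ forall x y, 0 <= d x y,
      forall x y, d x y = 0 <-> x = y,
      forall x y, d x y = d y x &
      forall x y z, d x z <= d x y + d y z].

Definition metric_compatible (R : realType) (X : topologicalType)
    (d : X -> X -> R) : Prop :=
  forall (x : X) (A : set X),
    nbhs x A <-> exists2 e : R, 0 < e & [set y | d x y < e] `<=` A.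

(* The limit is taken in the topology of X; this is convergence for d as soon
   as d is compatible with that topology. *)
Definition metric_complete (R : realType) (X : topologicalType)
    (d : X -> X -> R) : Prop :=
  forall u : nat -> X,
    (forall e : R, 0 < e ->
       exists N : nat, forall m n : nat, (N <= m)%N -> (N <= n)%N ->
         d (u m) (u n) < e) ->
    exists l : X, u @ \oo --> l.

(* Only the topology of X is part of the data, not the metric. The choice of
   R is immaterial, all instances of realType being isomorphic. *)
Definition polish (R : realType) (X : topologicalType) : Prop :=
  separable_space X /\
  exists d : X -> X -> R,
    [/\ is_metric d, metric_compatible d & metric_complete d].

Definition uncountable (X : Type) : Prop := ~ countable [set: X].

Definition borel (X : topologicalType) : set (set X) := <<s @open X >>.

Definition sigma_ideal (X : Type) (I : set (set X)) : Prop :=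
  [/\ I set0,
      forall A B : set X, A `<=` B -> I B -> I A &
      forall F : nat -> set X, (forall n, I (F n)) -> I (\bigcup_n F n)].

Record polish_ideal_space (R : realType) (X : topologicalType)
    (I : set (set X)) : Prop := PolishIdealSpace {
  pis_polish : polish R X;
  pis_uncountable : uncountable X;
  pis_sigma_ideal : sigma_ideal I;
  pis_proper : ~ I [set: X];
  pis_singletons : forall x : X, I [set x];
  pis_borel_base : forall A : set X, I A ->
    exists B : set X, [/\ borel B, I B & A `<=` B]
}.

Definition borel_plus (X : topologicalType) (I : set (set X)) : set (set X) :=
  borel (X := X) `\` I.

Definition borel_bar (X : topologicalType) (I : set (set X)) : set (set X) :=
  <<s borel (X := X) `|` I >>.

Definition borel_bar_measurable (X Y : topologicalType) (I : set (set X))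
    (f : X -> Y) : Prop :=
  forall U : set Y, open U -> borel_bar I (f @^-1` U).

Definition completely_nonmeasurable (X : topologicalType) (I : set (set X))
    (A : set X) : Prop :=
  forall B : set X, borel_plus I B ->
    A `&` B !=set0 /\ (~` A) `&` B !=set0.

(* Main.v *)
(* Modulo a Borel set [N] in [I], the preimages under [f] of a countable
   separating family of open sets of [Y] are Borel. Hence for [B] Borel and not in
   [I], the set [f @` (B `\` N)] is a continuous image of a closed subset of the
   Baire space, and it is uncountable since the fibres of [f] are in [I]; by a
   Cantor scheme it then receives an injection of [nat -> bool]. As all continuous
   images of closed subsets of the Baire space are coded by elements of
   [nat -> bool], Bernstein's transfinite construction provides a set [T] that
   splits all the uncountable ones simultaneously. *)

Require Import Defs.
From mathcomp Require Import all_boot all_order all_algebra.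
From mathcomp Require Import all_classical all_reals topology measure num_normedtype.
From mathcomp Require Import interval_inference wochoice.
From Stdlib Require Import Inverse_Image.

From mathcomp Require Import lra.

Set Implicit Arguments.
Unset Strict Implicit.
Unset Printing Implicit Defensive.

Import Order.TTheory GRing.Theory Num.Theory.
Local Open Scope classical_set_scope.
Local Open Scope ring_scope.

(** * Bernstein's construction by transfinite recursion *)

(* If some initial segment of a well-order receives an injection from [T], pull
   the order back along an injection into the least such segment. *)
Lemma initial_well_order (T : eqType) : exists lt : T -> T -> Prop,
  [/\ well_founded lt, forall x y, x <> y -> lt x y \/ lt y x &
      forall x (h : T -> T), injective h -> ~ forall y, lt (h y) x].
Proof.
have [le le_wo] := well_ordering_principle T.
pose lt x y := ~~ le y x.
have le_min (P : set T) : P !=set0 -> exists2 z, P z & forall y, P y -> le z y.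
  move=> [x Px]; have [|z [[/asboolP Pz minz] _]] := le_wo (fun x => `[< P x >]).
    by exists x; apply/asboolP.
  by exists z => // y Py; apply: minz; apply/asboolP.
have lt_wf : well_founded lt.
  move=> x; apply: contrapT => nacc_x.
  have [|z nacc_z minz] := le_min [set x | ~ Acc lt x]; first by exists x.
  apply: nacc_z; constructor => y; rewrite /lt => /negP zy.
  by apply: contrapT => /minz.
have le_total x y : x <> y -> lt x y \/ lt y x.
  move=> xy; rewrite /lt; case: (boolP (le x y)) => xley; last by right.
  left; apply/negP => ylex; apply: xy.
  have le_anti : {in predT &, antisymmetric le}.
    by apply: wo_chain_antisymmetric; exact: withinW.
  by apply: le_anti; rewrite ?xley ?ylex.
pose small x := forall h : T -> T, injective h -> ~ forall y, lt (h y) x.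
have [allsmall|/existsNP[x0 nx0]] := pselect (forall x, small x).
  by exists lt; split => // x h; exact: allsmall.
have [|z nz minz] := le_min [set x | ~ small x]; first by exists x0.
move: nz => /existsNP[h /not_implyP[hinj /contrapT hz]].
exists (fun x y => lt (h x) (h y)); split.
- exact: (@wf_inverse_image _ _ lt h lt_wf).
- by move=> x y xy; apply: le_total => /hinj.
- move=> x k kinj kx.
  have /contrapT/(_ (h \o k)) : ~ ~ small (h x).
    by move=> /minz; apply/negP; exact: hz.
  by apply; [exact: inj_comp | exact: kx].
Qed.

(** Transfinite recursion: if the values chosen before [j] covered the range of [h], sending each
    [k] to an earlier index whose value is [h k] would inject [J] into the segment below [j], which
    the order forbids. *)
Lemma injective_selector (J : eqType) (Y : Type) (A : J -> set Y)
    (Abig : forall j, exists2 h : J -> Y, injective h & forall k, A j (h k)) :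
  exists2 z : J -> Y, injective z & forall j, A j (z j).
Proof.
have [lt [lt_wf lt_tot lt_small]] := initial_well_order J.
have step j (z : forall i, lt i j -> Y) :
    {y | A j y /\ forall i (ij : lt i j), z i ij <> y}.
  apply: cid; apply: contrapT => /forallNP no.
  have [h hinj hA] := Abig j.
  have ex k : exists i, exists ij : lt i j, z i ij = h k.
    have /not_andP[/(_ (hA k))//|/existsNP[i /existsNP[ij /contrapT e]]] := no (h k).
    by exists i, ij.
  have [r rP] := choice ex.
  apply: (lt_small j r); last by move=> k; case: (rP k).
  move=> k k' e; apply: hinj; case: (rP k) (rP k') => i1 <- [i2 <-].
  by move: i1 i2; rewrite e => i1 i2; rewrite (Prop_irrelevance i1 i2).
pose z := Fix lt_wf (fun _ => Y) (fun j z => sval (step j z)).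
have zE j : z j = sval (step j (fun i _ => z i)).
  rewrite /z Fix_eq //= => x g g' gg'.
  suff -> : g = g' by [].
  by apply: functional_extensionality_dep => y; apply/funext => ?; exact: gg'.
have zlt i j : lt i j -> z i <> z j.
  by move=> ij; rewrite (zE j); have [_] := svalP (step j (fun i _ => z i)); exact.
exists z.
  by move=> i j e; apply: contrapT => /lt_tot[] /zlt; rewrite e.
by move=> j; rewrite zE; have [] := svalP (step j (fun i _ => z i)).
Qed.

(** Each big [A a] is listed twice, under [cons true a] and [cons false a], so an injective selector
    picks two of its points. [T] collects the points of the first kind; injectivity keeps those of
    the second kind out. *)
Lemma splitting_set (Y : Type) (A : (nat -> bool) -> set Y) :
  exists T : set Y, forall a,
    (exists2 h : (nat -> bool) -> Y, injective h & forall k, A a (h k)) ->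
    A a `&` T !=set0 /\ A a `&` ~` T !=set0.
Proof.
pose big (B : set Y) :=
  exists2 h : (nat -> bool) -> Y, injective h & forall k, B (h k).
have [[a0 biga0]|nobig] := pselect (exists a, big (A a)); last first.
  by exists set0 => a biga; case: nobig; exists a.
pose tail (a : nat -> bool) n := a n.+1.
pose cons b (a : nat -> bool) n := if n is n'.+1 then a n' else b.
(* Sets that are not big are replaced by the big set [A a0], since the selector requires every
   member to be big. *)
pose A' a := if `[< big (A (tail a)) >] then A (tail a) else A a0.
have bigA' a : big (A' a) by rewrite /A'; case: asboolP.
have [z zinj zA'] := injective_selector bigA'.
have zA b a : big (A a) -> A a (z (cons b a)).
  by move=> biga; have := zA' (cons b a); rewrite /A' (asboolT biga).
exists [set z (cons true a) | a in setT] => a biga; split.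
  by exists (z (cons true a)); split; [exact: zA | exists a].
exists (z (cons false a)); split; first exact: zA.
by move=> [a' _ /zinj] /(congr1 (fun u => u 0%N)).
Qed.

(** * Images of closed subsets of the Baire space *)

Definition agree (m : nat) (s t : nat -> nat) : Prop :=
  forall k, (k < m)%N -> s k = t k.

(** Closedness in the product topology with [nat] discrete, expressed by finite prefixes. *)
Definition baire_closed (C : set (nat -> nat)) : Prop :=
  forall s, (forall m, exists2 t, C t & agree m s t) -> C s.

Definition baire_continuous (X : Type) (U : set (set X)) (C : set (nat -> nat))
    (phi : (nat -> nat) -> X) : Prop :=
  forall V s, U V -> C s -> V (phi s) ->
  exists m, forall t, C t -> agree m s t -> V (phi t).

(* Continuity is only required with respect to the family [U], which is enlarged
   below by non-open sets in order to make [f] continuous along [phi]. *)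
Definition analytic (X : Type) (U : set (set X)) (A : set X) : Prop :=
  exists C phi, [/\ baire_closed C, baire_continuous U C phi & phi @` C = A].

Definition separating (X : Type) (U : set (set X)) : Prop :=
  forall x y, x <> y ->
  exists V W, [/\ U V, U W, V x, W y & V `&` W `<=` set0].

Lemma agreeW m n s t : (m <= n)%N -> agree n s t -> agree m s t.
Proof. by move=> mn st k km; apply: st; exact: leq_trans km mn. Qed.

(** The first entry of a code selects the index [n]; the remaining entries code a point of [A n]. *)
Lemma analytic_bigcup (X : Type) (U : set (set X)) (A : nat -> set X) :
  (forall n, analytic U (A n)) -> analytic U (\bigcup_n A n).
Proof.
move=> /choice[C /choice[phi phiP]].
pose tl (s : nat -> nat) k := s k.+1.
have agree_tl m s t : agree m.+1 s t -> agree m (tl s) (tl t).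
  by move=> st k km; apply: st.
exists [set s | C (s 0%N) (tl s)], (fun s => phi (s 0%N) (tl s)); split.
- move=> s clos; have [clC _ _] := phiP (s 0%N); apply: clC => m.
  have [t Ct st] := clos m.+1; exists (tl t); last exact: agree_tl.
  by rewrite (st 0%N).
- move=> V s UV Cs Vs; have [_ cts _] := phiP (s 0%N).
  have [m mP] := cts V (tl s) UV Cs Vs; exists m.+1 => t Ct st.
  have s0 := st 0%N isT; rewrite /= -s0 in Ct *.
  by apply: mP => //; exact: agree_tl.
- apply/seteqP; split=> [_ [s Cs <-]|x [n _]].
    by exists (s 0%N) => //; have [_ _ <-] := phiP (s 0%N); exists (tl s).
  have [_ _ <-] := phiP n; move=> [s Cs <-].
  by exists (fun k => if k is k'.+1 then s k' else n).
Qed.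

(** A code interleaves one code per [A n], all naming the same point. Separation by [U] makes this
    coincidence a closed condition, and continuity for [W n] is read off row [n]. *)
Lemma analytic_bigcap (X : Type) (U : set (set X)) (W : nat -> set (set X))
    (A : nat -> set X) :
  separating U -> (forall n, U `<=` W n) ->
  (forall n, analytic (W n) (A n)) ->
  analytic (\bigcup_n W n) (\bigcap_n A n).
Proof.
move=> sepU UW /choice[C /choice[phi phiP]].
pose row (n : nat) (s : nat -> nat) (k : nat) := s (pickle (n, k)).
have agree_row n m : exists M, forall s t, agree M s t -> agree m (row n s) (row n t).
  (* This bound exceeds the finitely many positions that hold the first [m] entries of row [n]. *)
  exists (\max_(k < m) (pickle (n, val k)).+1) => s t st k km.
  by apply: st; exact: (leq_bigmax (Ordinal km)).
pose D := [set s | forall n, C n (row n s) /\ phi n (row n s) = phi 0%N (row 0%N s)].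
have D_row n s : D s -> C n (row n s) by move=> /(_ n)[].
have cts n V s : W n V -> C n (row n s) -> V (phi n (row n s)) ->
    exists m, forall t, D t -> agree m s t -> V (phi n (row n t)).
  move=> WV Cs Vs; have [_ cts _] := phiP n; have [m mP] := cts V _ WV Cs Vs.
  have [M MP] := agree_row n m; exists M => t Dt st.
  by apply: mP; [exact: D_row | exact: MP].
exists D, (fun s => phi 0%N (row 0%N s)); split.
- move=> s clos; have Cs n : C n (row n s).
    have [clC _ _] := phiP n; apply: clC => m; have [M MP] := agree_row n m.
    have [t Dt st] := clos M; exists (row n t); first exact: D_row.
    exact: MP.
  move=> n; split=> //; apply: contrapT => /sepU[V [V' [UV UV' Vs V's VV']]].
  have [m mP] := cts n V s (UW _ _ UV) (Cs n) Vs.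
  have [m' m'P] := cts 0%N V' s (UW _ _ UV') (Cs 0%N) V's.
  have [t Dt st] := clos (maxn m m').
  apply: (VV' (phi n (row n t))); split.
    by apply: mP => //; apply: agreeW st; exact: leq_maxl.
  have [_ ->] := Dt n; apply: m'P => //; apply: agreeW st; exact: leq_maxr.
- move=> V s [n _ WV] Ds; rewrite -(Ds n).2 => /(cts n _ _ WV (D_row n s Ds))[m mP].
  by exists m => t Dt st; rewrite -(Dt n).2; exact: mP.
- apply/seteqP; split=> [_ [s Ds <-] n _|x Ax].
    by have [_ _ <-] := phiP n; exists (row n s); [exact: D_row | exact: (Ds n).2].
  have /choice[s sP] n : exists s, C n s /\ phi n s = x.
    by have := Ax n I; have [_ _ <-] := phiP n; case=> s Cs <-; exists s.
  pose u p := if unpickle p is Some (n, k) then s n k else 0%N.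
  have uE n : row n u = s n by apply/funext => k; rewrite /row /u pickleK.
  exists u; last by rewrite uE (sP _).2.
  by move=> n; rewrite !uE !(sP _).2; split=> //; exact: (sP n).1.
Qed.

(** The codes sent into [V] form a relatively open set, so the remaining ones are still closed. *)
Lemma analytic_setD (X : Type) (U : set (set X)) (A V : set X) :
  U V -> analytic U A -> analytic U (A `\` V).
Proof.
move=> UV [C [phi [clC cts <-]]]; exists [set s | C s /\ ~ V (phi s)], phi; split.
- move=> s clos; have Cs : C s.
    by apply: clC => m; have [t [Ct _] st] := clos m; exists t.
  split=> // Vs; have [m mP] := cts V s UV Cs Vs.
  by have [t [Ct nVt] st] := clos m; apply: nVt; exact: mP.
- move=> W s UW [Cs _] Ws; have [m mP] := cts W s UW Cs Ws.
  by exists m => t [Ct _]; exact: mP.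
- apply/seteqP; split=> [_ [s [Cs nVs] <-]|_ [[s Cs <-] nVs]]; last by exists s.
  by split=> //; exists s.
Qed.

(* A set contained in or disjoint from [A] is vacuously relatively clopen. *)
Lemma analytic_adjoin (X : Type) (U : set (set X)) (A D : set X) :
  A `<=` D \/ A `<=` ~` D -> analytic U A -> analytic (U `|` [set D]) A.
Proof.
move=> AD [C [phi [clC cts im]]]; exists C, phi; split=> // V s [UV|->] Cs Vs.
  exact: cts.
exists 0%N => t Ct _.
have imA r : C r -> A (phi r) by move=> Cr; rewrite -im; exists r.
by case: AD => AD; [exact/AD/imA | have := AD _ (imA _ Cs)].
Qed.

(** Within [D] and within its complement, [D] is everything or nothing, so both parametrizations
    accept it and can be glued. *)
Lemma analytic_decide (X : Type) (U : set (set X)) (D : set X) :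
  analytic U D -> analytic U (~` D) -> analytic (U `|` [set D]) setT.
Proof.
move=> anD anCD; have -> : [set: X] = \bigcup_n (if n is 0%N then D else ~` D).
  apply/seteqP; split=> // x _; have [Dx|nDx] := pselect (D x).
    by exists 0%N.
  by exists 1%N.
apply: analytic_bigcup => -[|n]; apply: analytic_adjoin => //.
  by left.
by right.
Qed.

(** * Polish spaces and their Borel sets *)

Lemma vanishing_radii (R : realType) : exists r : nat -> R,
  (forall n, 0 < r n) /\ forall e, 0 < e -> \forall n \near \oo, r n < e.
Proof.
exists (fun n => n.+1%:R^-1); split=> [n|e e0]; first by rewrite invr_gt0.
exact: (near_infty_natSinv_lt (PosNum e0)).
Qed.

Section PolishMetric.
Variables (R : realType) (X : topologicalType) (d : X -> X -> R).
Hypotheses (dm : is_metric d) (dtop : metric_compatible d).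

Let d_ge0 x y : 0 <= d x y. Proof. by case: dm. Qed.
Let d_eq0 x y : d x y = 0 -> x = y. Proof. by case: dm => _ /(_ x y)[]. Qed.
Let d_xx x : d x x = 0. Proof. by case: dm => _ /(_ x x)[_ ->]. Qed.
Let d_sym x y : d x y = d y x. Proof. by case: dm. Qed.
Let d_tri x y z : d x z <= d x y + d y z. Proof. by case: dm. Qed.

Lemma metric_open (V : set X) :
  open V <-> forall x, V x -> exists2 e : R, 0 < e & [set y | d x y < e] `<=` V.
Proof.
rewrite openE; split=> [oV x /oV|oV x /oV]; first by move/dtop.
by move=> ?; apply/dtop.
Qed.

Lemma open_metric_ball x (e : R) : open [set y | d x y < e].
Proof.
apply/metric_open => y /= xy; exists (e - d x y); first by rewrite subr_gt0.
by move=> z /=; rewrite ltrBrDl; apply: le_lt_trans.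
Qed.

(** The path from [x] to [y] through [a], a common point [z] and [b] has four legs shorter than
    [e]. *)
Lemma metric_ball_disjoint x y a b (e : R) :
  e + e + e + e <= d x y -> d a x < e -> d b y < e ->
  [set z | d a z < e] `&` [set z | d b z < e] `<=` set0.
Proof.
move=> exy ax bY z [/= az bz].
have := d_tri x a y; have := d_tri a z y; have := d_tri z b y.
rewrite (d_sym x a) (d_sym z b); lra.
Qed.

Lemma separating_open : separating (@open X).
Proof.
move=> x y xy; pose e := d x y / 4%:R.
have d0 : 0 < d x y.
  by rewrite lt_neqAle d_ge0 andbT eq_sym; apply/eqP => /d_eq0.
have e0 : 0 < e by rewrite divr_gt0.
exists [set z | d x z < e], [set z | d y z < e]; split=> /=.
- exact: open_metric_ball.
- exact: open_metric_ball.
- by rewrite d_xx.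
- by rewrite d_xx.
- by apply: (@metric_ball_disjoint x y); rewrite ?d_xx //; rewrite /e; lra.
Qed.

(** An open set is a countable union of closed sets, the complements of the open sets [G n] of
    points closer than [r n] to the complement of [V]. *)
Lemma analytic_open (V : set X) :
  analytic (@open X) setT -> open V -> analytic (@open X) V.
Proof.
move=> anX oV.
have [r [r0 small]] := vanishing_radii R.
pose G n := [set x | exists2 y, ~ V y & d x y < r n].
have -> : V = \bigcup_n (setT `\` G n).
  apply/seteqP; split=> [x Vx|x [n _ [_ nG]]].
    have /metric_open/(_ x Vx)[e e0 eV] := oV.
    have [n ne] := filter_ex (small _ e0).
    exists n => //; split=> // -[y nVy xy]; apply: nVy; apply: eV => /=.
    exact: lt_trans xy ne.
  by apply: contrapT => nVx; apply: nG; exists x => //; rewrite d_xx.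
apply: analytic_bigcup => n; apply: analytic_setD => //.
have -> : G n = \bigcup_(y in ~` V) [set x | d y x < r n].
  apply/seteqP; split=> [x [y nVy xy]|x [y nVy xy]]; exists y => //.
    by rewrite /= d_sym.
  by rewrite d_sym.
by apply: bigcup_open => y _; exact: open_metric_ball.
Qed.

Variable q : nat -> X.
Hypothesis q_dense : forall x (e : R), 0 < e -> exists n, d x (q n) < e.

Lemma separating_dense_balls :
  exists V : nat -> set X, (forall n, open (V n)) /\ separating (range V).
Proof.
have [r [r0 small]] := vanishing_radii R.
pose ball n m := [set x | d (q n) x < r m].
exists (fun p => if unpickle p is Some (n, m) then ball n m else set0); split.
  move=> p; case: unpickle => [[n m]|]; last exact: open0.
  exact: open_metric_ball.
move=> x y xy.
have d0 : 0 < d x y.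
  by rewrite lt_neqAle d_ge0 andbT eq_sym; apply/eqP => /d_eq0.
have e0 : 0 < d x y / 4%:R by rewrite divr_gt0.
have [m me] := filter_ex (small _ e0).
have [i ix] := q_dense x (r0 m); have [j jy] := q_dense y (r0 m).
exists (ball i m), (ball j m); split.
- by exists (pickle (i, m)); rewrite ?pickleK.
- by exists (pickle (j, m)); rewrite ?pickleK.
- by rewrite /ball /= d_sym.
- by rewrite /ball /= d_sym.
- apply: (@metric_ball_disjoint x y _ _ (r m)); [lra|by rewrite d_sym|by rewrite d_sym].
Qed.

(** A sequence [s] codes the point within [r n] of each [q (s n)]. Non-strict inequalities and
    completeness make the set of codes closed; vanishing radii make the coded point unique. *)
Lemma analytic_setT : metric_complete d -> analytic (@open X) setT.
Proof.
move=> dcomp; have [r [r0 small]] := vanishing_radii R.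
pose near (s : nat -> nat) x := forall n, d x (q (s n)) <= r n.
have phiP s : exists x, (exists x, near s x) -> near s x.
  have [[x nx]|no] := pselect (exists x, near s x); first by exists x.
  by exists (q 0%N) => /no.
have [phi {}phiP] := choice phiP.
exists [set s | exists x, near s x], phi; split.
- move=> s clos.
  have qs m n : d (q (s m)) (q (s n)) <= r m + r n.
    have [t [x tx] st] := clos (maxn m n).+1.
    have := tx m; have := tx n; rewrite -!st ?ltnS ?leq_maxl ?leq_maxr //.
    have := d_tri (q (s m)) x (q (s n)); rewrite (d_sym _ x); lra.
  have [l ul] : exists l : X, (q \o s) @ \oo --> l.
    apply: (dcomp (q \o s)) => e e0; have e20 : 0 < e / 2 by rewrite divr_gt0.
    have [N _ NP] := small _ e20; exists N => m n Nm Nn /=.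
    by have := qs m n; have := NP m Nm; have := NP n Nn; rewrite /=; lra.
  exists l => n; apply/ler_addgt0Pr => e e0.
  have e20 : 0 < e / 2 by rewrite divr_gt0.
  have near_l : nbhs l [set y | d l y < e / 2] by apply/dtop; exists (e / 2).
  have ulm : \forall m \near \oo, d l (q (s m)) < e / 2 := ul _ near_l.
  have [m [/= lm me]] := filter_ex (filterI ulm (small _ e20)).
  have := d_tri l (q (s m)) (q (s n)); have := qs m n; lra.
- move=> V s oV /phiP sphi Vs; have /metric_open/(_ _ Vs)[e e0 eV] := oV.
  have e20 : 0 < e / 2 by rewrite divr_gt0.
  have [n ne] := filter_ex (small _ e20).
  exists n.+1 => t /phiP tphi st; apply: eV => /=.
  have := sphi n; have := tphi n; rewrite (st n) //.
  have := d_tri (phi s) (q (t n)) (phi t); rewrite (d_sym (q (t n))); lra.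
- apply/seteqP; split=> // x _.
  have /choice[s sx] n : exists k, d x (q k) < r n.
    by exact: q_dense.
  have nx : near s x by move=> n; exact: ltW.
  have nphi : near s (phi s) by apply: phiP; exists x.
  exists s; first by exists x.
  apply: d_eq0; apply/eqP; rewrite eq_le d_ge0 andbT.
  apply/ler_addgt0Pr => e e0; have e20 : 0 < e / 2 by rewrite divr_gt0.
  have [n ne] := filter_ex (small _ e20).
  have := nx n; have := nphi n; have := d_tri (phi s) (q (s n)) x.
  rewrite (d_sym (q (s n)) x); lra.
Qed.

End PolishMetric.

Lemma separable_dense_sequence (R : realType) (X : topologicalType)
    (d : X -> X -> R) (x0 : X) :
  is_metric d -> metric_compatible d -> separable_space X ->
  exists q : nat -> X, forall x (e : R), 0 < e -> exists n, d x (q n) < e.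
Proof.
move=> dm dtop [D /countable_injP[g ginj] denseD].
have qP n : exists x, forall y, D y -> g y = n -> x = y.
  have [[y [Dy <-]]|no] := pselect (exists y, D y /\ g y = n).
    by exists y => z Dz e; apply: ginj; rewrite ?inE.
  by exists x0 => y Dy e; case: no; exists y.
have [q {}qP] := choice qP.
exists q => x e e0.
have [|y [xy Dy]] := denseD [set y | d x y < e] _ (open_metric_ball dm dtop x e).
  by exists x => /=; case: dm => _ /(_ x x)[_ ->].
by exists (g y); rewrite (qP _ y).
Qed.

(** Sets that are analytic together with their complements form a sigma-algebra containing the open
    sets. *)
Lemma analytic_borel (R : realType) (X : topologicalType) (A : set X) :
  polish R X -> X -> borel A -> analytic (@open X) A.
Proof.
move=> [sepX [d [dm dtop dcomp]]] x0.
have [q qP] := separable_dense_sequence x0 dm dtop sepX.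
have anT := analytic_setT dm dtop qP dcomp.
suff : @borel X `<=` [set B | analytic (@open X) B /\ analytic (@open X) (~` B)].
  by move=> sub /sub[].
apply: smallest_sub => [|V oV]; last first.
  split; first exact: (analytic_open dm dtop).
  by rewrite -setTD; exact: analytic_setD.
split.
- have an0 : analytic (@open X) set0.
    by rewrite -(setDv setT); apply: analytic_setD => //; exact: openT.
  by rewrite /= setC0.
- by move=> B [anB anCB] /=; rewrite setTD setCK.
- move=> F anF; split; first by apply: analytic_bigcup => n; case: (anF n).
  have -> : @open X = \bigcup_(n : nat) @open X.
    by apply/seteqP; split=> [V oV|V []//]; exists 0%N.
  rewrite setC_bigcup; apply: (@analytic_bigcap _ (@open X)) => //.
    exact: (separating_open dm dtop).
    by move=> _ V.
  by move=> n; case: (anF n).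
Qed.

(** * The perfect set property *)

Definition cylinder (C : set (nat -> nat)) (s : seq nat) : set (nat -> nat) :=
  [set t | C t /\ agree (size s) (nth 0%N s) t].

Lemma cylinder_mkseq C t m t' :
  cylinder C (mkseq t m) t' <-> C t' /\ agree m t t'.
Proof.
rewrite /cylinder /= size_mkseq; split=> -[Ct' tt']; split=> // k km.
  by rewrite -tt' ?nth_mkseq.
by rewrite nth_mkseq ?tt'.
Qed.

Lemma cylinder_limit C (s : nat -> seq nat) : baire_closed C ->
  (forall n, cylinder C (s n) !=set0) ->
  (forall n, cylinder C (s n.+1) `<=` cylinder C (s n)) ->
  (forall n, n <= size (s n))%N ->
  exists t, forall n, cylinder C (s n) t.
Proof.
move=> clC /choice[t ts] sS szs.
have sub m n : (m <= n)%N -> cylinder C (s n) `<=` cylinder C (s m).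
  elim: n => [|n IH]; first by rewrite leqn0 => /eqP ->.
  by rewrite leq_eqVlt => /predU1P[-> //|/IH sub]; exact: subset_trans (sS n) sub.
(* Node [k.+1] is longer than [k], so its entry [k] is genuine and shared by all points of the later
   cylinders. *)
pose l k := nth 0%N (s k.+1) k.
have lt_ n k : (k < n)%N -> l k = t n k.
  by move=> kn; have [_ e] := sub _ _ kn _ (ts n); apply: e; exact: szs.
exists l => n; split.
  apply: clC => m; exists (t m); first by case: (ts m).
  by move=> k; exact: lt_.
move=> k kn; rewrite (lt_ (maxn n k.+1)) ?leq_maxr //.
by have [_ ->] := sub n (maxn n k.+1) (leq_maxl _ _) _ (ts _).
Qed.

Section PerfectSet.
Variables (Y : Type) (U : set (set Y)) (C : set (nat -> nat)).
Variable g : (nat -> nat) -> Y.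
Hypotheses (sepU : separating U) (clC : baire_closed C).
Hypothesis cts_g : baire_continuous U C g.

Let big s := ~ countable (g @` cylinder C s).

(* Remove from the cylinder of [s] all subcylinders with countable image: two
   remaining points with distinct images provide the two branches. *)
Let big_split s : big s -> exists c : bool -> seq nat,
  [/\ forall b, big (c b), forall b, cylinder C (c b) `<=` cylinder C s,
      forall b, (size s < size (c b))%N &
      forall t t', cylinder C (c true) t -> cylinder C (c false) t' ->
        g t <> g t'].
Proof.
move=> bigs.
pose S := [set t | cylinder C s t /\ forall n, big (mkseq t n)].
have [[t [t' [[st tbig] [st' t'big] tt']]]|Strivial] :=
    pselect (exists t t', [/\ S t, S t' & g t <> g t']).
  have [Ct Ct'] : C t /\ C t' by case: st st' => + _ [].
  have [V [V' [UV UV' Vt V't' VV']]] := sepU tt'.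
  have [m mP] := cts_g UV Ct Vt; have [m' m'P] := cts_g UV' Ct' V't'.
  (* Length [M] makes both branches longer than [s] and lets the prefixes of [t] and [t'] force the
     images into [V] and [V']. *)
  pose M := maxn (size s).+1 (maxn m m').
  have [sM mM m'M] : [/\ size s < M, m <= M & m' <= M]%N.
    by rewrite /M !leq_max !leqnn !orbT.
  have sub u : cylinder C s u -> cylinder C (mkseq u M) `<=` cylinder C s.
    move=> [Cu su] v /cylinder_mkseq[Cv uv]; split=> // k ks.
    by rewrite su // uv //; exact: ltn_trans sM.
  exists (fun b => mkseq (if b then t else t') M); split.
  - by case.
  - by case; exact: sub.
  - by move=> b; rewrite size_mkseq.
  - move=> v v' /cylinder_mkseq[Cv tv] /cylinder_mkseq[Cv' t'v'] e.
    apply: (VV' (g v)); split; first by apply: mP => //; exact: agreeW tv.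
    by rewrite e; apply: m'P => //; exact: agreeW t'v'.
exfalso; apply: bigs.
(* Now [g] is constant on [S], so a countable union covers the image of the cylinder: [None] gives
   the image of [S], at most one point, and [Some u] the image of the cylinder of [u] whenever it is
   countable. *)
pose F (o : option (seq nat)) := if o is Some u
  then (if `[< big u >] then set0 else g @` cylinder C u) else g @` S.
apply: (@sub_countable _ _ _ (\bigcup_o F o)).
  apply: subset_card_le => _ [t st <-].
  have [tbig|/existsNP[n nbig]] := pselect (forall n, big (mkseq t n)).
    by exists None => //; exists t.
  exists (Some (mkseq t n)) => //=; rewrite asboolF //; exists t => //.
  by apply/cylinder_mkseq; split=> //; case: st.
apply: bigcup_countable => // -[u _|_] /=.
  by case: asboolP => [_|/contrapT//]; exact: countable0.
have [[t0 St0]|S0] := pselect (S !=set0); last first.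
  have -> : S = set0 by apply/seteqP; split=> // t St; apply: S0; exists t.
  by rewrite image_set0; exact: countable0.
apply: (@sub_countable _ _ _ [set g t0]); last exact: countable1.
apply: subset_card_le => _ [t St <-]; apply: contrapT => tt0.
by apply: Strivial; exists t, t0.
Qed.

(** Splitting repeatedly along [a] gives decreasing cylinders with a common point [t a]. For
    distinct [a] and [b] the nodes coincide up to the first difference, where the split separates
    the images. *)
Lemma uncountable_image_continuum : ~ countable (g @` C) ->
  exists2 h : (nat -> bool) -> Y, injective h & forall a, (g @` C) (h a).
Proof.
move=> uncC.
have /choice[c cP] s : exists c : bool -> seq nat, big s ->
  [/\ forall b, big (c b), forall b, cylinder C (c b) `<=` cylinder C s,
      forall b, (size s < size (c b))%N &
      forall t t', cylinder C (c true) t -> cylinder C (c false) t' ->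
        g t <> g t'].
  have [bigs|] := pselect (big s); last by exists (fun=> [::]).
  by have [c cP] := big_split bigs; exists c.
pose node (a : nat -> bool) := fix node n :=
  if n is n'.+1 then c (node n') (a n') else [::].
have bignode a n : big (node a n).
  elim: n => [|n /cP[bigc _ _ _]]; last exact: bigc.
  rewrite /big /=; congr (~ countable (g @` _)): uncC.
  by apply/seteqP; split=> [t Ct|t []].
have /choice[t tP] a : exists t, forall n, cylinder C (node a n) t.
  apply: cylinder_limit => // n.
  - apply: contrapT => /set0P/negP/negPn/eqP n0; apply: (bignode a n).
    by rewrite n0 image_set0; exact: countable0.
  - by have [_ + _ _] := cP _ (bignode a n); apply.
  - elim: n => // n IH; have [_ _ sz _] := cP _ (bignode a n).
    exact: leq_ltn_trans IH (sz _).
exists (g \o t); last by move=> a; exists (t a) => //; case: (tP a 0%N).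
move=> a b gab; apply/funext => k; apply/eqP; apply: contrapT => abk.
have [n abn minn] := @ex_minnP (fun k => a k != b k) (ex_intro _ k (introN idP abk)).
have eq_node m : (m <= n)%N -> node a m = node b m.
  elim: m => // m IH mn /=; rewrite IH ?(ltnW mn) //; congr (c _ _).
  by apply/eqP; apply: contraTT mn => /minn; rewrite -leqNgt.
have [_ _ _ disj] := cP _ (bignode a n).
have := tP a n.+1; have := tP b n.+1; rewrite /= -eq_node //.
case: (a n) (b n) abn => -[] // _ tb ta; first exact: disj ta tb gab.
exact: disj tb ta (esym gab).
Qed.

End PerfectSet.

(** * Coding continuous images by binary sequences *)

(* Up to equality of images, pairs [(C, g)] are coded by the relations "[C] meets
   the cylinder of [s]" and "[g] maps the cylinder of [s] into [V n]". *)
Lemma continuous_image_code (Y : Type) (V : nat -> set Y) :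
  separating (range V) ->
  exists code : (nat -> bool) -> set Y, forall C g,
    baire_closed C -> baire_continuous (range V) C g ->
    exists a, code a = g @` C.
Proof.
move=> sepV.
(* For the code of [(C, g)], the first clause forces [t] into the closed set [C]; the second says
   that [y] and [g t] lie in the same sets [V n], hence are equal by separation. *)
exists (fun a => [set y | exists t : nat -> nat,
  (forall m, a (pickle (mkseq t m, None : option nat))) /\
  forall n, V n y <-> exists m, a (pickle (mkseq t m, Some n))]).
move=> C g clC cts.
pose P (x : seq nat * option nat) := if x.2 is Some n
  then cylinder C x.1 `<=` g @^-1` V n else cylinder C x.1 !=set0.
exists (fun p => if unpickle p is Some x then `[< P x >] else false).
have VgP t n : C t -> V n (g t) <-> exists m, P (mkseq t m, Some n).
  move=> Ct; split=> [Vt|[m]]; last first.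
    by move=> /(_ t); apply; apply/cylinder_mkseq; split.
  have [m mP] := cts (V n) t (imageT _ _) Ct Vt.
  by exists m => t' /cylinder_mkseq[Ct' tt']; exact: mP.
apply/seteqP; split=> [y /= [t [tC Vy]]|_ [t Ct <-]].
  have Ct : C t.
    apply: clC => m; have := tC m; rewrite pickleK => /asboolP[t' /cylinder_mkseq[]].
    by exists t'.
  exists t => //; apply: contrapT => /sepV[_ [_ [[n _ <-] [n' _ <-] Vt Vy' dis]]].
  apply: (dis y); split=> //; apply/Vy.
  have [m Pm] := (VgP t n Ct).1 Vt.
  by exists m; rewrite pickleK; apply/asboolP.
exists t; split=> [m|n].
  rewrite pickleK; apply/asboolP; exists t; exact/cylinder_mkseq.
rewrite VgP //; split=> -[m Pm]; exists m.
  by rewrite pickleK; apply/asboolP.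
by move: Pm; rewrite pickleK => /asboolP.
Qed.

(** * Borel sets modulo the ideal, and the theorem *)

Lemma borel_setC (X : topologicalType) (A : set X) : borel A -> borel (~` A).
Proof.
move=> bA; have [_ bC _] := smallest_sigma_algebra [set: X] open.
by rewrite -setTD; exact: bC.
Qed.

Lemma borel_bigcup (X : topologicalType) (F : nat -> set X) :
  (forall n, borel (F n)) -> borel (\bigcup_n F n).
Proof.
by move=> bF; have [_ _ bU] := smallest_sigma_algebra [set: X] open; exact: bU.
Qed.

Lemma borel_setD_bigcup (X : topologicalType) (B : set X) (F : nat -> set X) :
  borel B -> (forall n, borel (F n)) -> borel (B `\` \bigcup_n F n).
Proof.
move=> bB bF; have -> : B `\` \bigcup_n F n =
    ~` \bigcup_n (if n is n'.+1 then F n' else ~` B).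
  rewrite setC_bigcup; apply/seteqP; split=> [x [Bx nF] [|n] _|x nx].
  - by rewrite setCK.
  - by move=> Fx; apply: nF; exists n.
  - split; first by have := nx 0%N I; rewrite setCK.
    by move=> [n _]; exact: nx n.+1 I.
apply: borel_setC; apply: borel_bigcup; case=> [|n]; [exact: borel_setC | exact: bF].
Qed.

Lemma sigma_ideal_countable_bigcup (X T : Type) (I : set (set X)) (D : set T)
    (F : T -> set X) : sigma_ideal I -> countable D ->
  (forall y, D y -> I (F y)) -> I (\bigcup_(y in D) F y).
Proof.
move=> [I0 Isub Ibig] /countable_injP[e einj] IF.
apply: (Isub _ (\bigcup_n \bigcup_(y in [set y | D y /\ e y = n]) F y)).
  by move=> x [y Dy Fx]; exists (e y) => //; exists y.
apply: Ibig => n; have [[y [Dy ey]]|no] := pselect (exists y, D y /\ e y = n).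
  apply: Isub (IF y Dy) => x [z [Dz ez]].
  by rewrite (einj z y) ?inE // ez ey.
by apply: Isub I0 => x [y Dy _]; apply: no; exists y.
Qed.

(** The sets with such [D] and [N] form a sigma-algebra. It contains the Borel sets, with [N] empty,
    and the members of [I], with [D] empty and [N] from the Borel base. *)
Lemma borel_bar_mod_ideal (R : realType) (X : topologicalType)
    (I : set (set X)) (A : set X) : polish_ideal_space R I -> borel_bar I A ->
  exists D N, [/\ borel D, borel N, I N & forall x, ~ N x -> A x <-> D x].
Proof.
move=> [_ _ [I0 _ Ibig] _ _ Ibase].
have b0 : borel (X := X) set0 by have [] := smallest_sigma_algebra [set: X] open.
suff : borel_bar I `<=` [set A | exists D N,
  [/\ borel D, borel N, I N & forall x, ~ N x -> A x <-> D x]] by move=> /[apply].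
apply: smallest_sub => [|B [bB|/Ibase[N [bN IN BN]]]]; last 2 first.
- by exists B, set0.
- exists set0, N; split=> // x nNx; split=> // Bx; exact/nNx/BN.
split.
- by exists set0, set0.
- move=> B [D [N [bD bN IN BD]]]; exists (~` D), N; split=> //.
    exact: borel_setC.
  by move=> x /BD BDx; rewrite setTD /= BDx.
- move=> F /choice[D /choice[N DNP]].
  exists (\bigcup_n D n), (\bigcup_n N n); split.
  + by apply: borel_bigcup => n; have [] := DNP n.
  + by apply: borel_bigcup => n; have [] := DNP n.
  + by apply: Ibig => n; have [] := DNP n.
  + move=> x nNx; have FD n : F n x <-> D n x.
      by have [_ _ _] := DNP n; apply => Nx; apply: nNx; exists n.
    by split=> -[n _ /FD]; exists n.
Qed.

(* Adjoining the sets [D n], decided along the parametrization, makes any map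
   that is determined by them on [B] continuous. *)
Lemma analytic_clopen (R : realType) (X : topologicalType) (D : nat -> set X)
    (B : set X) : polish R X -> X -> borel B -> (forall n, borel (D n)) ->
  exists2 U : set (set X), range D `<=` U & analytic U B.
Proof.
move=> polX x0 bB bD.
have sepX : separating (@open X).
  by have [_ [d [dm dtop _]]] := polX; exact: separating_open dm dtop.
(* Stage [0] carries [B] with the open sets, stage [n.+1] the whole space with [D n] adjoined;
   intersecting the stages leaves [B] with every [D n] adjoined. *)
pose W n := if n is n'.+1 then @open X `|` [set D n'] else @open X.
exists (\bigcup_n W n); first by move=> _ [n _ <-]; exists n.+1 => //; right.
have -> : B = \bigcap_n (if n is 0%N then B else setT).
  by apply/seteqP; split=> [x Bx [|n]|x /(_ 0%N I)].
apply: (analytic_bigcap sepX) => -[|n] //=; try by move=> ? ?; left.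
  exact: analytic_borel polX x0 bB.
apply: analytic_decide; apply: (analytic_borel polX x0) => //.
exact: borel_setC.
Qed.

Theorem theorem2p2 (R : realType) (X Y : topologicalType) (I : set (set X))
    (HX : polish_ideal_space R I) (HY : polish R Y) (uncY : uncountable Y)
    (f : X -> Y) (mf : borel_bar_measurable I f)
    (If : forall y : Y, I (f @^-1` [set y])) :
  exists T : set Y, completely_nonmeasurable I (f @^-1` T).
Proof.
have [polX _ sigI nIT _ _] := HX; have [I0 Isub Ibig] := sigI.
have [x0 _] : [set: X] !=set0.
  by apply: contrapT => /set0P/negP/negPn/eqP X0; apply: nIT; rewrite X0.
have [V [oV sepV]] : exists V : nat -> set Y,
    (forall n, open (V n)) /\ separating (range V).
  have [sepY [d [dm dtop _]]] := HY.
  have [q qP] := separable_dense_sequence (f x0) dm dtop sepY.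
  exact (separating_dense_balls dm dtop qP).
have /choice[D /choice[N DNP]] n := borel_bar_mod_ideal HX (mf _ (oV n)).
have [code codeP] := continuous_image_code sepV.
have [T TP] := splitting_set code.
(* Only a set of [I] is removed, so [B0] stays outside [I]. *)
exists T => B [bB nIB]; pose B0 := B `\` \bigcup_n N n.
have bB0 : borel B0 by apply: borel_setD_bigcup => // n; have [] := DNP n.
have nIB0 : ~ I B0.
  move=> IB0; apply: nIB.
  apply: (Isub _ (\bigcup_n (if n is n'.+1 then N n' else B0))).
    move=> x Bx; have [[n _ Nx]|nNx] := pselect ((\bigcup_n N n) x).
      by exists n.+1.
    by exists 0%N.
  by apply: Ibig => -[//|n]; have [] := DNP n.
have fD n x : B0 x -> V n (f x) <-> D n x.
  move=> [_ nNx]; have [_ _ _] := DNP n; apply => Nx.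
  by apply: nNx; exists n.
have [U DU [C [phi [clC cts im]]]] : exists2 U, range D `<=` U & analytic U B0.
  by apply: analytic_clopen polX x0 bB0 _ => n; have [] := DNP n.
have B0phi t : C t -> B0 (phi t) by move=> Ct; rewrite -im; exists t.
(* On [B0] the preimage of [V n] under [f] is [D n], a member of [U], for which [phi] is
   continuous. *)
have ctsf : baire_continuous (range V) C (f \o phi).
  move=> _ s [n _ <-] Cs /fD-/(_ (B0phi _ Cs)) Ds.
  have [m mP] := cts (D n) s (DU _ (imageT _ _)) Cs Ds.
  by exists m => t Ct /(mP _ Ct) /(fD _ _ (B0phi _ Ct)).
have unc : ~ countable ((f \o phi) @` C).
  rewrite -image_comp im => cB0; apply: nIB0.
  apply: Isub (sigma_ideal_countable_bigcup sigI cB0 (fun y _ => If y)).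
  by move=> x B0x; exists (f x) => //; exists x.
have [a ca] := codeP C _ clC ctsf.
have := TP a; rewrite ca => /(_ (uncountable_image_continuum sepV clC ctsf unc)).
move=> [[_ [[t Ct <-] Tt]] [_ [[t' Ct' <-] nTt']]].
have [[Bt _] [Bt' _]] := (B0phi t Ct, B0phi t' Ct').
by split; [exists (phi t) | exists (phi t')].
Qed.
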